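(* Let $G$ be a connected graph with $n\ge 2$ vertices and $m$ edges. Then $$0\le \mathrm{irr}_{\mathrm{Tr}}(G)\le m(n-2)$$ and $$0\le \sum_{uv\in E(G)}\left(\sigma(u)-\sigma(v)\right)^2\le m(n-2)^2.$$ In each of the two lines, equality on the right-hand side holds if and only if $G$ is isomorphic to the star $S_n$, and equality on the left-hand side holds if and only if $G$ is transmission regular.
   Context: All graphs are finite and simple. For a connected graph $G$, $d(u,v)$ is the graph distance and the transmission of a vertex $v$ is $\sigma(v)=\sum_{u\in V(G)}d(v,u)$. $G$ is transmission regular if $\sigma(u)=\sigma(v)$ for all vertices $u,v$. The transmission irregularity is $\mathrm{irr}_{\mathrm{Tr}}(G)=\sum_{uv\in E(G)}|\sigma(u)-\sigma(v)|$. $S_n$ is the star with $n$ vertices, i.e. $K_{1,n-1}$. *)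

(* Defs.v *)
From mathcomp Require Import all_boot all_order all_algebra.

Set Implicit Arguments.
Unset Strict Implicit.
Unset Printing Implicit Defensive.

Import Order.TTheory GRing.Theory Num.Theory.

Record sgraph (V : finType) := SGraph {
  adj : rel V;
  adj_sym : symmetric adj;
  adj_irrefl : irreflexive adj }.

Definition connected (V : finType) (G : sgraph V) : Prop :=
  forall u v : V, connect (adj G) u v.

Definition edges (V : finType) (G : sgraph V) : {set {set V}} :=
  [set [set p.1; p.2] | p : V * V & adj G p.1 p.2].

Definition isomorphic (V W : finType) (G : sgraph V) (H : sgraph W) : Prop :=
  exists2 f : V -> W, bijective f & forall u v, adj H (f u) (f v) = adj G u v.

Definition star_rel (n : nat) : rel 'I_n :=
  fun i j => (i != j) && ((i == 0 :> nat) || (j == 0 :> nat)).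

Lemma star_rel_sym (n : nat) : symmetric (@star_rel n).
Proof. by move=> i j; rewrite /star_rel eq_sym orbC. Qed.

Lemma star_rel_irrefl (n : nat) : irreflexive (@star_rel n).
Proof. by move=> i; rewrite /star_rel eqxx. Qed.

Definition star (n : nat) : sgraph 'I_n :=
  SGraph (@star_rel_sym n) (@star_rel_irrefl n).

Definition has_walk (V : finType) (G : sgraph V) (u v : V) (k : nat) : bool :=
  [exists p : k.-tuple V, path (adj G) u p && (last u p == v)].

(* The least length of a walk from u to v. A shortest walk has fewer than #|V|
   edges, so bounding k loses nothing; vertices in different components get the
   junk value #|V|. *)
Definition dist (V : finType) (G : sgraph V) (u v : V) : nat :=
  \big[minn/#|V|]_(k < #|V| | has_walk G u v k) k.

Lemma dist_le (V : finType) (G : sgraph V) (u : V) (p : seq V) :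
  path (adj G) u p -> dist G u (last u p) <= size p.
Proof.
case/shortenP=> q Gq Uq sub_qp; have /andP[_ uq] := Uq.
have lt_qV : size q < #|V|.
  by rewrite -[_.+1]/(size (u :: q)) -(card_uniqP Uq) max_card.
apply: leq_trans (uniq_leq_size uq sub_qp); rewrite /dist.
have Wq : has_walk G u (last u q) (Ordinal lt_qV).
  by apply/existsP; exists (in_tuple q); rewrite /= Gq eqxx.
rewrite -big_filter; have : Ordinal lt_qV \in
  [seq k <- index_enum 'I_#|V| | has_walk G u (last u q) (nat_of_ord k)].
  by rewrite mem_filter Wq mem_index_enum.
elim: filter => // k s IHs; rewrite inE big_cons => /predU1P[<-|/IHs].
  exact: geq_minl.
exact/leq_trans/geq_minr.
Qed.

Lemma dist_attained (V : finType) (G : sgraph V) (u v : V) :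
  connect (adj G) u v -> has_walk G u v (dist G u v).
Proof.
case/connectP=> p Gp ->.
case/shortenP: Gp => q Gq Uq _.
have lt_qV : size q < #|V|.
  by rewrite -[_.+1]/(size (u :: q)) -(card_uniqP Uq) max_card.
have : dist G u (last u q) < #|V| by apply: leq_ltn_trans lt_qV; exact: dist_le.
rewrite /dist.
elim/big_ind: _ => [|x y IHx IHy|//]; first by rewrite ltnn.
by rewrite /minn; case: ifP.
Qed.

Definition transmission (V : finType) (G : sgraph V) (v : V) : nat :=
  \sum_(u : V) dist G v u.

Definition transmission_regular (V : finType) (G : sgraph V) : Prop :=
  forall u v : V, transmission G u = transmission G v.

Local Open Scope ring_scope.

(* The value f u v at the edge [set u; v], for symmetric f (see edge_valE);
   pick makes an irrelevant choice of the order of the endpoints. *)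
Definition edge_val (V : finType) (f : V -> V -> int) (e : {set V}) : int :=
  if [pick p : V * V | e == [set p.1; p.2]] is Some p then f p.1 p.2 else 0.

Lemma edge_valE (V : finType) (f : V -> V -> int) (u v : V) :
  (forall x y, f x y = f y x) -> edge_val f [set u; v] = f u v.
Proof.
move=> fC; rewrite /edge_val; case: pickP => [[x y] /= /eqP E|/(_ (u, v))];
  last by rewrite eqxx.
have := set22 x y; have := set21 x y; rewrite -E !inE => xuv yuv.
have := set22 u v; have := set21 u v; rewrite E !inE => uxy vxy.
case/orP: xuv => /eqP xE; case/orP: yuv => /eqP yE;
  case/orP: uxy => /eqP uE; case/orP: vxy => /eqP vE;
  by have := fC x y; congruence.
Qed.

Definition edge_sum (V : finType) (G : sgraph V) (f : V -> V -> int) : int :=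
  \sum_(e in edges G) edge_val f e.

Definition irr_Tr (V : finType) (G : sgraph V) : int :=
  edge_sum G (fun u v => `|(transmission G u)%:Z - (transmission G v)%:Z|).

(* Main.v *)
Require Import Defs.
From mathcomp Require Import all_boot all_order all_algebra.
From mathcomp Require Import perm zify.

(** Let [u] and [v] be the ends of an edge.  For a vertex [w] other than [u]
    and [v], the distances from [u] and from [v] to [w] differ by at most one;
    for [w = u] and [w = v] the two contributions cancel in the difference of
    the transmissions.  Hence [transmission G v] exceeds [transmission G u] by
    at most [#|V| - 2].  Equality means that every other vertex is strictly
    closer to [u] than to [v], which happens exactly when [u] is the only
    neighbour of [v] ([transmission_leqif]).  So the bound [#|V| - 2] on
    [|transmission G u - transmission G v|] is attained exactly at the edges
    with an end of degree one ([transmission_gap_leif]).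

    Summing over the edges gives both upper bounds, with equality exactly when
    every edge has an end of degree one.  The connected graphs of order at
    least two with this property are the stars ([all_edges_pendant_star]).
    The sums vanish exactly when the transmission does not change along any
    edge, which by connectedness means that it is constant
    ([transmission_regularP]).  As squaring is increasing on nonnegative
    integers, one argument serves both sums ([edge_sum_transmission_bounds]). *)

Set Implicit Arguments.
Unset Strict Implicit.
Unset Printing Implicit Defensive.

Import Order.TTheory GRing.Theory Num.Theory.

(** An end of an edge has a neighbour, so there the bound means degree exactly
    one. *)
Definition leaf (V : finType) (G : sgraph V) (v : V) : bool :=
  #|[pred w | adj G v w]| <= 1.

Lemma leafP (V : finType) (G : sgraph V) (u v : V) :
  adj G v u -> reflect (forall w, adj G v w -> w = u) (leaf G v).
Proof.
move=> vu; rewrite /leaf; apply: (iffP card_le1_eqP) => [eqN w vw | eqN w w'].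
  by apply: eqN; rewrite inE.
by rewrite !inE => /eqN-> /eqN->.
Qed.

Definition all_edges_pendant (V : finType) (G : sgraph V) : Prop :=
  forall u v, adj G u v -> leaf G u || leaf G v.

Definition star_at (V : finType) (G : sgraph V) (c : V) : Prop :=
  forall x y, adj G x y = (x != y) && ((x == c) || (y == c)).

Section Distance.

Variables (V : finType) (G : sgraph V).
Hypothesis conG : connected G.
Implicit Types u v w : V.

Lemma geodesic u v :
  exists2 p, path (adj G) u p & v = last u p /\ size p = dist G u v.
Proof.
case/existsP: (dist_attained (conG u v)) => p /andP[Gp /eqP v_last].
by exists p; rewrite ?size_tuple.
Qed.

Lemma dist_id u : dist G u u = 0.
Proof. by apply/eqP; rewrite -leqn0; apply: (@dist_le _ G u [::]). Qed.

Lemma dist_eq0 u v : (dist G u v == 0) = (u == v).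
Proof.
apply/eqP/eqP=> [d0 | ->]; last exact: dist_id.
have [p _ []] := geodesic u v.
by rewrite d0; case: p.
Qed.

Lemma dist_adj u v : adj G u v -> dist G u v = 1.
Proof.
move=> uv; have neq_uv: u != v by apply: contraTneq uv => ->; rewrite adj_irrefl.
have: dist G u v <= 1 by apply: (@dist_le _ G u [:: v]); rewrite /= uv.
by move: neq_uv; rewrite -dist_eq0; case: dist => [|[]].
Qed.

Lemma dist_adj_le u v w : adj G v u -> dist G v w <= (dist G u w).+1.
Proof.
move=> vu; have [p Gp [-> <-]] := geodesic u w.
by apply: (@dist_le _ G v (u :: p)); rewrite /= vu.
Qed.

Lemma dist_leaf u v w :
  adj G v u -> leaf G v -> w != v -> dist G v w = (dist G u w).+1.
Proof.
move=> vu /(leafP vu) onlyu neq_wv; apply/eqP; rewrite eqn_leq dist_adj_le //=.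
(* The second vertex of a geodesic from v to w can only be u. *)
have [[|x p] /= Gp [w_last <-]] := geodesic v w.
  by rewrite w_last eqxx in neq_wv.
case/andP: Gp => /onlyu xu Gp; rewrite xu in Gp w_last.
by rewrite ltnS w_last dist_le.
Qed.

(** The distances to [u] and [v] contribute one to either side, and each of the
    other [#|V| - 2] vertices contributes a surplus of at most one. *)
Lemma transmission_leqif u v :
  adj G v u ->
  transmission G v <= transmission G u + (#|V| - 2) ?= iff leaf G v.
Proof.
move=> vu; have uv: adj G u v by rewrite adj_sym.
have neq_vu: v != u by apply: contraTneq vu => ->; rewrite adj_irrefl.
pose P w := (w != u) && (w != v).
have splitE x : transmission G x =
    dist G x u + (dist G x v + \sum_(w | P w) dist G x w).
  rewrite /transmission (bigD1 u) //= (bigD1 v) //=.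
have cardP: #|V| - 2 = \sum_(w | P w) 1.
  rewrite sum1_card -(cardC (pred2 u v)) card2 eq_sym neq_vu addKn.
  by apply: eq_card => w; rewrite !inE negb_or.
rewrite cardP (splitE v) (splitE u) !dist_id (dist_adj vu) (dist_adj uv) !add0n.
rewrite -addnA -big_split /=.
have sum_le: \sum_(w | P w) dist G v w <= \sum_(w | P w) (dist G u w + 1)
    ?= iff [forall (w | P w), dist G v w == dist G u w + 1].
  apply: leqif_sum => w _; split=> //.
  by rewrite addn1 dist_adj_le.
suff <-: [forall (w | P w), dist G v w == dist G u w + 1] = leaf G v.
  by case: sum_le => le1 eq1; split; rewrite ?leq_add2l // eqn_add2l.
apply/forall_inP/idP=> [gap | leafv w /andP[_ neq_wv]]; last first.
  by rewrite addn1 (dist_leaf vu).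
(* Another neighbour w of v would be at distance 1 from v, hence 0 from u. *)
apply/(leafP vu) => w vw; apply/eqP; apply: contraT => neq_wu.
have Pw: P w.
  by rewrite /P neq_wu; apply: contraTneq vw => ->; rewrite adj_irrefl.
have := gap w Pw; rewrite (dist_adj vw) addn1 eqSS eq_sym dist_eq0 eq_sym.
by rewrite (negbTE neq_wu).
Qed.

Lemma transmission_regularP :
  (forall u v, adj G u v -> transmission G u = transmission G v)
  <-> transmission_regular G.
Proof.
split=> [Gadj u v | reg u v _]; last exact: reg.
have /connectP[p Gp ->] := conG u v.
by elim: p u Gp => //= x p IHp u /andP[/Gadj-> /IHp].
Qed.

(** Let [c] be a neighbour of a leaf [l].  No neighbour [w] of [c] has a
    neighbour [x] other than [c]: then [w] would not be a leaf, so [c] would be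
    one, with [l = w] as its sole neighbour, and [w] would be a leaf after
    all.  Thus [c] and its neighbours form a connected component. *)
Lemma all_edges_pendant_star :
  2 <= #|V| -> (all_edges_pendant G <-> exists c, star_at G c).
Proof.
move=> V2; split=> [pend | [c starc] u v]; last first.
  rewrite starc => /andP[neq_uv uv_c]; apply/orP.
  have leafN x : x != c -> leaf G x.
    move=> neq_xc; apply/(@leafP _ G c) => [|w].
      by rewrite starc eqxx neq_xc orbT.
    by rewrite starc (negbTE neq_xc) => /andP[_ /eqP].
  case: (eqVneq u c) neq_uv => [-> neq_cv | /leafN]; last by left.
  by right; apply: leafN; rewrite eq_sym.
have [c [l cl leafl]]: exists c, exists2 l, adj G c l & leaf G l.
  have [a [b [_ _ neq_ab]]]: exists a, exists b : V, [/\ a \in V, b \in V & a != b].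
    by apply/card_gt1P.
  have [[|x p] /= Gp [b_last _]] := geodesic a b.
    by rewrite b_last eqxx in neq_ab.
  case/andP: Gp => ax _; case/orP: (pend a x ax) => [leafa | leafx].
    by exists x, a; rewrite // adj_sym.
  by exists a, x.
have lc: adj G l c by rewrite adj_sym.
have nbrs w x : adj G c w -> adj G w x -> x = c.
  move=> cw wx; have wc: adj G w c by rewrite adj_sym.
  case/orP: (pend c w cw) => [/(leafP cw)/(_ l cl) lw | /(leafP wc)]; last exact.
  by rewrite -lw in wx; exact: (leafP lc leafl).
have dom x : x != c -> adj G c x.
  have /connectP[p Gp ->] := conG c x.
  elim/last_ind: p Gp => [|p y IHp]; first by rewrite eqxx.
  rewrite rcons_path last_rcons => /andP[/IHp Gp py] neq_yc.
  case: (eqVneq (last c p) c) py => [-> // | /Gp cz zy].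
  by rewrite (nbrs _ _ cz zy) eqxx in neq_yc.
exists c => x y; apply/idP/andP=> [xy | [neq_xy /orP[]/eqP E]].
- split; first by apply: contraTneq xy => ->; rewrite adj_irrefl.
  case: (eqVneq x c) => //= /dom cx.
  by rewrite (nbrs _ _ cx xy).
- by rewrite E dom // -E eq_sym.
- by rewrite E adj_sym dom // -E.
Qed.

End Distance.

Lemma isomorphic_star (V : finType) (G : sgraph V) :
  2 <= #|V| -> (isomorphic G (star #|V|) <-> exists c, star_at G c).
Proof.
move=> V2; have V0 : 0 < #|V| by apply: ltnW.
pose o : 'I_#|V| := Ordinal V0.
have is_o (i : 'I_#|V|) : (i == 0 :> nat) = (i == o) by [].
split=> [[f bijf adjf] | [c starc]].
  have [g fK gK] := bijf.
  exists (g o) => x y; rewrite -adjf /= /star_rel !is_o (inj_eq (can_inj fK)).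
  by rewrite !(can2_eq fK gK).
(* Any enumeration of V, corrected by a transposition so that c comes first. *)
pose f x := tperm (enum_rank c) o (enum_rank x).
have bijf: bijective f.
  by apply: bij_comp (enum_rank_bij V); exists (tperm (enum_rank c) o); apply: tpermK.
exists f => // u v; have injf := bij_inj bijf.
have fc: f c = o by rewrite /f tpermL.
by rewrite /= /star_rel !is_o -fc !(inj_eq injf) starc.
Qed.

Local Open Scope ring_scope.

Section EdgeSum.

Variables (V : finType) (G : sgraph V).

Lemma edge_val_adjP (f : V -> V -> int) (Q : int -> Prop) :
  (forall x y, f x y = f y x) ->
  (forall e, e \in edges G -> Q (edge_val f e))
  <-> (forall u v, adj G u v -> Q (f u v)).
Proof.
move=> fC; split=> [Qe u v uv | Quv e /imsetP[[u v]]].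
  by rewrite -(edge_valE u v fC); apply/Qe/imsetP; exists (u, v); rewrite ?inE.
by rewrite inE /= => uv ->; rewrite edge_valE //; apply: Quv.
Qed.

Lemma edge_sum_const (c : int) :
  \sum_(e in edges G) c = #|edges G|%:Z * c.
Proof. by rewrite sumr_const -mulr_natl natz. Qed.

Lemma edge_sum_bounds (f : V -> V -> int) (c : int) :
  (forall x y, f x y = f y x) -> (forall u v, adj G u v -> 0 <= f u v <= c) ->
  [/\ 0 <= edge_sum G f <= #|edges G|%:Z * c,
      edge_sum G f = #|edges G|%:Z * c <-> (forall u v, adj G u v -> f u v = c)
    & 0 = edge_sum G f <-> (forall u v, adj G u v -> f u v = 0)].
Proof.
move=> fC f_bd.
have e_bd e : e \in edges G -> 0 <= edge_val f e <= c.
  by apply: (edge_val_adjP (fun x => 0 <= x <= c) fC).2 e.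
have sum_le: edge_sum G f <= #|edges G|%:Z * c
    ?= iff [forall (e | e \in edges G), edge_val f e == c].
  rewrite -edge_sum_const; apply: leif_sum => e /e_bd /andP[_ le_c].
  by split.
have sum_ge0: 0 <= edge_sum G f by apply: sumr_ge0 => e /e_bd /andP[].
split; first by rewrite sum_ge0 sum_le.
  apply: iff_trans (edge_val_adjP (fun x => x = c) fC).
  split=> [/eqP | E]; first by rewrite sum_le => /forall_inP E e /E /eqP.
  by apply/eqP; rewrite sum_le; apply/forall_inP=> e /E ->.
apply: iff_trans (edge_val_adjP (fun x => x = 0) fC).
split=> [/esym E e eG | E]; last by rewrite /edge_sum big1.
by apply: (psumr_eq0P _ E) => // i /e_bd /andP[].
Qed.

End EdgeSum.

Section TransmissionSums.

Variables (V : finType) (G : sgraph V).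
Hypotheses (V2 : (2 <= #|V|)%N) (conG : connected G).

Let gap u v : int := `|(transmission G u)%:Z - (transmission G v)%:Z|.

Lemma transmission_gap_leif u v :
  adj G u v -> gap u v <= #|V|%:Z - 2 ?= iff (leaf G u || leaf G v).
Proof.
move=> uv; have vu: adj G v u by rewrite adj_sym.
have [le_u eq_u] := transmission_leqif conG uv.
have [le_v eq_v] := transmission_leqif conG vu.
rewrite -eq_u -eq_v /gap; split; first by lia.
by apply/eqP/orP; rewrite -!(rwP eqP); lia.
Qed.

(** The gap enters through a function [g] that is injective and increasing on
    nonnegative integers, so that [g] of the gap reaches [g 0] and
    [g (#|V| - 2)] exactly where the gap reaches [0] and [#|V| - 2]. *)
Lemma edge_sum_transmission_bounds (f : V -> V -> int) (g : int -> int) :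
  g 0 = 0 -> {in Num.nneg &, {mono g : x y / x <= y}} ->
  (forall u v, f u v = g (gap u v)) ->
  [/\ 0 <= edge_sum G f <= #|edges G|%:Z * g (#|V|%:Z - 2),
      edge_sum G f = #|edges G|%:Z * g (#|V|%:Z - 2)
        <-> isomorphic G (star #|V|)
    & 0 = edge_sum G f <-> transmission_regular G].
Proof.
move=> g0 g_mono fE.
have nn_gap u v : gap u v \is Num.nneg by rewrite nnegrE normr_ge0.
have nn0 : (0 : int) \is Num.nneg by rewrite nnegrE.
have nnV : #|V|%:Z - 2 \is Num.nneg by rewrite nnegrE; lia.
have g_eq x y : x \is Num.nneg -> y \is Num.nneg -> (g x == g y) = (x == y).
  by move=> nnx nny; rewrite !eq_le !g_mono.
have fC x y : f x y = f y x by rewrite !fE /gap distrC.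
have f_bd u v : adj G u v -> 0 <= f u v <= g (#|V|%:Z - 2).
  move=> uv; rewrite fE -{1}g0 !g_mono // normr_ge0 /=.
  exact: transmission_gap_leif.
have [bounds eq_max eq_min] := edge_sum_bounds fC f_bd.
split=> //.
  apply: iff_trans eq_max _; apply: iff_trans (iff_sym (isomorphic_star G V2)).
  apply: iff_trans (all_edges_pendant_star conG V2).
  split=> E u v uv.
    rewrite -(transmission_gap_leif uv).2 -g_eq // -fE.
    by apply/eqP/E.
  by apply/eqP; rewrite fE g_eq // (transmission_gap_leif uv).2 E.
apply: iff_trans eq_min _; apply: iff_trans (transmission_regularP conG).
have f_eq0 u v : (f u v == 0) = (transmission G u == transmission G v).
  by rewrite fE -{1}g0 g_eq // /gap normr_eq0 subr_eq0.
by split=> E u v uv; apply/eqP; [rewrite -f_eq0 | rewrite f_eq0]; apply/eqP/E.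
Qed.

End TransmissionSums.

Theorem lemma1 (V : finType) (G : sgraph V) (n m : nat)
    (hn : #|V| = n) (hm : #|edges G| = m) (hn2 : (2 <= n)%N)
    (hG : connected G) :
  [/\ 0 <= irr_Tr G <= m%:Z * (n%:Z - 2),
      irr_Tr G = m%:Z * (n%:Z - 2) <-> isomorphic G (star n)
    & 0 = irr_Tr G <-> transmission_regular G] /\
  [/\ 0 <= edge_sum G (fun u v => ((transmission G u)%:Z - (transmission G v)%:Z) ^+ 2)
        <= m%:Z * (n%:Z - 2) ^+ 2,
      edge_sum G (fun u v => ((transmission G u)%:Z - (transmission G v)%:Z) ^+ 2)
        = m%:Z * (n%:Z - 2) ^+ 2 <-> isomorphic G (star n)
    & 0 = edge_sum G (fun u v => ((transmission G u)%:Z - (transmission G v)%:Z) ^+ 2)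
        <-> transmission_regular G].
Proof.
subst n m; split.
  exact: (@edge_sum_transmission_bounds _ _ hn2 hG _ id).
apply: (@edge_sum_transmission_bounds _ _ hn2 hG _ (fun x => x ^+ 2)).
- by rewrite expr0n.
- by move=> x y; rewrite !nnegrE => x0 y0; rewrite ler_pXn2r.
- by move=> u v; rewrite real_normK // num_real.
Qed.
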